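(* Let $G$ be a locally compact Abelian group which is also a topological vector space over $\mathbb{R}$. Let $\Omega_{+}$ and $\Omega_{-}$ be bounded $0$-symmetric sets in $G$ such that $r\overline{\Omega_{+}}\subset\operatorname{int}\Omega_{+}$ and $r\overline{\Omega_{-}}\subset\operatorname{int}\Omega_{-}$ for all $r\in[0,1)$. Then $\mathcal{C}^{*}_{G}(\operatorname{int}\Omega_{+},\operatorname{int}\Omega_{-})=\mathcal{C}^{*}_{G}(\overline{\Omega_{+}},\overline{\Omega_{-}})$.
   Context: All locally compact Abelian (LCA) groups are Hausdorff, written additively with identity $0$, and $\lambda_G$ denotes a fixed Haar measure on $G$. The topological vector space structure has the same addition and topology as the group. A set $\Omega\subset G$ is $0$-symmetric if $\Omega=-\Omega$. $\operatorname{int}$ denotes interior. Here $A \subset B$ does not mean strict inclusion. A function $f:G\to\mathbb{R}$ is positive definite if $\sum_{i=1}^{n}\sum_{j=1}^{n}c_i\overline{c_j}f(g_i-g_j)\ge 0$ for all $n\in\mathbb{N}$, $c_i\in\mathbb{C}$, $g_i\in G$. $P_1(G)$ is the set of continuous positive definite functions $f:G\to\mathbb{R}$ with $f(0)=1$. Write $f_+:=\max\{f,0\}$, $f_-:=\max\{-f,0\}$, and $\operatorname{supp} f:=\overline{\{g\in G: f(g)\neq 0\}}$. For subsets $\Omega_+,\Omega_-\subset G$, $$\mathcal{F}^{*}_{G}(\Omega_{+},\Omega_{-}):=\{f\in P_1(G)\cap L^1(G): \operatorname{supp} f_+\subset\Omega_{+},\ \operatorname{supp} f_-\subset\Omega_{-}\},$$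 $$\mathcal{C}^{*}_{G}(\Omega_{+},\Omega_{-}):=\sup_{f\in\mathcal{F}^{*}_{G}(\Omega_{+},\Omega_{-})}\int_G f\,d\lambda_G,$$ with the convention that the value is $0$ if the class is empty. *)

(* Defs.v *)
From HB Require Import structures.
From mathcomp Require Import all_boot all_order all_algebra.
From mathcomp Require Import complex.
From mathcomp Require Import all_classical all_reals all_analysis.

Set Implicit Arguments.
Unset Strict Implicit.
Unset Printing Implicit Defensive.

Import Order.TTheory GRing.Theory Num.Theory.
Import numFieldNormedType.Exports.

Local Open Scope classical_set_scope.
Local Open Scope ring_scope.

(* Measurable types are pointed; this alias points a topological group at 0. *)
Definition pointed_group (G : topologicalZmodType) : Type := G.
HB.instance Definition _ (G : topologicalZmodType) :=
  Choice.on (pointed_group G).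
HB.instance Definition _ (G : topologicalZmodType) :=
  isPointed.Build (pointed_group G) (0 : G).

Definition borel_group (G : topologicalZmodType) :=
  g_sigma_algebraType (open : set (set (pointed_group G))).

(* A Haar measure: a nonzero, translation-invariant Radon measure, i.e. finite
   on compact sets, outer regular on Borel sets, inner regular on open sets. *)
Record is_haar (R : realType) (G : topologicalZmodType)
    (lam : {measure set (borel_group G) -> \bar R}) : Prop := {
  haar_neq0 : lam [set: G] != 0%E ;
  haar_translation : forall (g : G) (A : set (borel_group G)),
    measurable A -> lam [set g + (x : G) | x in A] = lam A ;
  haar_compact : forall K : set G, compact K -> (lam K < +oo)%E ;
  haar_outer_regular : forall A : set (borel_group G), measurable A ->
    lam A = ereal_inf [set lam U | U in [set U : set G | open U /\ A `<=` U]] ;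
  haar_inner_regular : forall U : set G, open U ->
    lam U = ereal_sup [set lam K | K in [set K : set G | compact K /\ K `<=` U]]
}.

Definition positive_definite (R : realType) (G : zmodType) (f : G -> R) : Prop :=
  forall (n : nat) (c : 'I_n -> R[i]) (g : 'I_n -> G),
    0 <= \sum_(i < n) \sum_(j < n)
           c i * conjc (c j) * real_complex R (f (g i - g j)).

Definition P1 (R : realType) (G : topologicalZmodType) : set (G -> R) :=
  [set f | [/\ continuous f, positive_definite f & f 0 = 1]].

Definition supp (R : realType) (G : topologicalType) (f : G -> R) : set G :=
  closure [set g | f g != 0].

Definition Fstar (R : realType) (G : topologicalZmodType)
    (lam : {measure set (borel_group G) -> \bar R})
    (Op On : set G) : set (G -> R) :=
  [set f | [/\ P1 f,
    lam.-integrable [set: borel_group G] (EFin \o f),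
    supp f^\+ `<=` Op & supp f^\- `<=` On]].

(* The supremum is taken in \bar R. Since ereal_sup set0 = -oo, the empty
   class is treated apart. *)
Definition Cstar (R : realType) (G : topologicalZmodType)
    (lam : {measure set (borel_group G) -> \bar R})
    (Op On : set G) : \bar R :=
  if Fstar lam Op On == set0 then 0%E
  else ereal_sup [set (\int[lam]_x (f x)%:E)%E | f in Fstar lam Op On].

Definition zero_symmetric (G : zmodType) (A : set G) : Prop :=
  A = [set - x | x in A].

(* von Neumann boundedness *)
Definition tvs_bounded (R : realType) (G : topologicalLmodType R)
    (A : set G) : Prop :=
  forall U : set G, nbhs (0 : G) U ->
    exists2 s : R, 0 < s & forall t : R, s < t -> A `<=` [set t *: x | x in U].

(* Main.v *)
(* If f is admissible for the closures, then for s > 1 the dilation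
   x |-> f (s x) is admissible for the interiors, because s^-1 (closure Omega)
   lies in int Omega. Bounded closed sets are compact in a locally compact
   topological vector space, so f and its dilations are uniformly bounded and
   vanish outside one compact set; as s tends to 1, dominated convergence gives
   the convergence of the integrals. The scaling law of the Haar measure is thus
   not needed. *)
Require Import Defs.
From mathcomp Require Import all_boot all_order all_algebra.
From mathcomp Require Import all_classical all_reals all_analysis.
From mathcomp Require Import measurable_realfun.
Import Order.TTheory GRing.Theory Num.Theory.
Import numFieldNormedType.Exports.
Local Open Scope classical_set_scope.
Local Open Scope ring_scope.

Set Implicit Arguments.
Unset Strict Implicit.
Unset Printing Implicit Defensive.

Lemma continuous_scaler (R : realType) (G : topologicalLmodType R) (a : R) :
  continuous (fun x : G => a *: x).
Proof.
move=> x.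
apply: (@continuous_comp G (R^o * G)%type G (fun y => (a, y))
  (fun z => z.1 *: z.2)); last exact: scale_continuous.
by apply: (@cvg_pair _ _ _ _ (nbhs (a : R^o))); [exact: cvg_cst|exact: cvg_id].
Qed.

Lemma continuous_scalel (R : realType) (G : topologicalLmodType R) (x : G) :
  continuous (fun a : R^o => a *: x).
Proof.
move=> a.
apply: (@continuous_comp R^o (R^o * G)%type G (fun b => (b, x))
  (fun z => z.1 *: z.2)); last exact: scale_continuous.
by apply: (@cvg_pair _ _ _ _ (nbhs (a : R^o))); [exact: cvg_id|exact: cvg_cst].
Qed.

(** A compact neighbourhood [K] of 0 absorbs [A], so [A] lies in a dilate of [K]. That dilate is
    compact, hence closed since [G] is Hausdorff, and so contains [closure A] as a closed subset. *)
Lemma tvs_bounded_closure_compact (R : realType) (G : topologicalLmodType R)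
    (A : set G) : hausdorff_space G -> locally_compact [set: G] ->
  tvs_bounded A -> compact (closure A).
Proof.
move=> hG lcG bA.
have [K K0 [cK _]] := lcG 0 I; rewrite withinET in K0.
(* Absorption holds for factors strictly above [s], hence the factor [s + 1]. *)
have [s s0 /(_ (s + 1))] := bA _ K0; rewrite ltrDl ltr01 => /(_ isT) AK.
have csK : compact [set (s + 1) *: x | x in K].
  apply: continuous_compact cK; apply: continuous_subspaceT.
  exact: continuous_scaler.
apply: (subclosed_compact _ csK); first exact: closed_closure.
rewrite [X in _ `<=` X](iffLR (closure_id _) (compact_closed hG csK)).
exact: closureS.
Qed.

(** Meant for [h] a dilation: the quadratic form of [f \o h] at the points [g] is that of [f] at the
    points [h \o g]. *)
Lemma positive_definite_comp (R : realType) (G H : zmodType) (h : G -> H)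
    (f : H -> R) : {morph h : x y / x - y} ->
  positive_definite f -> positive_definite (f \o h).
Proof.
move=> hB pf n c g; have := pf n c (h \o g).
by under eq_bigr do under eq_bigr do rewrite /= -hB.
Qed.

Lemma open_borel_measurable (G : topologicalZmodType) (U : set G) :
  open U -> measurable (U : set (borel_group G)).
Proof. by move=> oU; apply: sub_sigma_algebra. Qed.

Lemma closed_borel_measurable (G : topologicalZmodType) (A : set G) :
  closed A -> measurable (A : set (borel_group G)).
Proof.
move=> cA; rewrite -[A]setCK; apply: measurableC.
by apply: open_borel_measurable; exact: closed_openC.
Qed.

Lemma continuous_borel_measurable (R : realType) (G : topologicalZmodType)
    (f : G -> R) : continuous f ->
  measurable_fun [set: borel_group G] (f : borel_group G -> R).
Proof.
move=> cf; apply: (measurability _ (RGenOInfty.measurableE R)).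
move=> _ [_ [x ->] <-]; rewrite setTI; apply: open_borel_measurable.
by apply: open_comp => // y _; exact: cf.
Qed.

(** The preimage of [supp f] under [h] is closed and contains every point where [f \o h] is
    nonzero. *)
Lemma supp_comp (R : realType) (G H : topologicalType) (h : G -> H)
    (f : H -> R) : continuous h -> supp (f \o h) `<=` h @^-1` supp f.
Proof.
move=> ch; have cl : closed (h @^-1` supp f).
  by apply: preimage_closed => [x _|]; [exact: ch|exact: closed_closure].
rewrite [X in _ `<=` X](iffLR (closure_id _) cl); apply: closureS => x fx.
exact: subset_closure.
Qed.

Lemma supp_dilation (R : realType) (G : topologicalLmodType R) (A B : set G)
    (s : R) (f : G -> R) : 0 < s ->
  [set s^-1 *: x | x in A] `<=` B -> supp f `<=` A ->
  supp (fun x => f (s *: x)) `<=` B.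
Proof.
move=> s0 AB fA x /(supp_comp (@continuous_scaler _ _ s)) fx; apply: AB.
by exists (s *: x); [exact: fA|rewrite scalerA mulVf ?gt_eqF// scale1r].
Qed.

(** A nonzero value of [f] has a strict sign, which puts the point in the support of [f^\+] or of
    [f^\-]. *)
Lemma supp_vanish (R : realType) (G : topologicalType) (f : G -> R)
    (A B : set G) (x : G) : supp f^\+ `<=` A -> supp f^\- `<=` B ->
  ~ (A `|` B) x -> f x = 0.
Proof.
move=> fA fB; apply: contra_notP => /eqP.
rewrite neq_lt => /orP[fx|fx]; [right; apply: fB|left; apply: fA];
  apply: subset_closure => /=.
- by rewrite /funrneg gt_eqF// lt_max oppr_gt0 fx.
- by rewrite /funrpos gt_eqF// lt_max fx.
Qed.

Lemma compact_support_bounded (R : realType) (G : topologicalType) (f : G -> R)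
    (K : set G) : compact K -> continuous f -> (forall x, ~ K x -> f x = 0) ->
  exists M : R, forall x, `|f x| <= M.
Proof.
move=> cK cf fK; have : compact (f @` K).
  by apply: continuous_compact cK; exact: continuous_subspaceT.
(* Every number above [M] bounds the image of [K]; the one chosen is also nonnegative, so it covers
   the value 0 taken off [K]. *)
move=> /compact_bounded [M [_ /(_ (`|M| + 1))]].
rewrite ltr_pwDr ?ler_norm// => /(_ isT) MfK; exists (`|M| + 1) => x.
have [Kx|/fK ->] := pselect (K x); first by apply: MfK; exists x.
by rewrite normr0 addr_ge0.
Qed.

Lemma integrable_cst_patch d (T : measurableType d) (R : realType)
    (mu : {measure set T -> \bar R}) (K : set T) (M : R) :
  measurable K -> (mu K < +oo)%E ->
  mu.-integrable [set: T] ((cst M%:E) \_ K).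
Proof.
move=> mK muK; apply/(integrable_mkcond _ mK)/integrableP.
split; first exact: measurable_cst.
by rewrite (integral_cst mu mK `|M%:E|) lte_mul_pinfty.
Qed.

Lemma integrable_compact_support (R : realType) (G : topologicalZmodType)
    (lam : {measure set (borel_group G) -> \bar R}) (f : G -> R) (K : set G) :
  closed K -> compact K -> (lam K < +oo)%E -> continuous f ->
  (forall x, ~ K x -> f x = 0) ->
  lam.-integrable [set: borel_group G] (EFin \o f).
Proof.
move=> clK cK lamK cf fK; have mK := @closed_borel_measurable _ _ clK.
have [M fM] := compact_support_bounded cK cf fK.
apply: (le_integrable measurableT _ _ (integrable_cst_patch M mK lamK)).
  by apply/measurable_EFinP; exact: continuous_borel_measurable.
move=> x _ /=; rewrite patchE; case: ifPn => [_|/negP]; rewrite ?inE.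
  by rewrite lee_fin (le_trans (fM _)) ?ler_norm.
by move=> /fK ->; rewrite normr0 abse_ge0.
Qed.

Lemma Fstar_dilation (R : realType) (G : topologicalLmodType R)
    (lam : {measure set (borel_group G) -> \bar R}) (Ap An Bp Bn : set G)
    (s : R) (f : G -> R) : 0 < s -> is_haar lam ->
  closed Ap -> closed An -> compact Ap -> compact An ->
  Bp `<=` Ap -> Bn `<=` An ->
  [set s^-1 *: x | x in Ap] `<=` Bp -> [set s^-1 *: x | x in An] `<=` Bn ->
  Fstar lam Ap An f -> Fstar lam Bp Bn (fun x => f (s *: x)).
Proof.
move=> s0 haar clp cln cp cn BAp BAn sp sn [[cf pf f0] _ fp fn].
have cfs : continuous (fun x => f (s *: x)).
  by move=> x; apply: continuous_comp; [exact: continuous_scaler|exact: cf].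
have supp_p := supp_dilation s0 sp fp.
have supp_n := supp_dilation s0 sn fn.
split => //.
- split => //; last by rewrite scaler0.
  by apply: (positive_definite_comp _ pf) => x y; rewrite scalerBr.
(* Integrability of the dilate comes from its support: it is continuous and vanishes off a compact
   set, which has finite Haar measure. *)
- have cK : compact (Ap `|` An) by exact: compactU.
  apply: (@integrable_compact_support _ _ lam _ (Ap `|` An)) => //.
  + exact: closedU.
  + exact: (haar_compact haar cK).
  + move=> x.
    exact: (supp_vanish (subset_trans supp_p BAp) (subset_trans supp_n BAn)).
Qed.

(** Since all dilates vanish off the same [K], the function equal to [M] on [K] and 0 elsewhere
    dominates them all at once. *)
Lemma cvg_integral_dilation (R : realType) (G : topologicalLmodType R)
    (lam : {measure set (borel_group G) -> \bar R}) (K : set G) (f : G -> R)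
    (s : R ^nat) :
  closed K -> compact K -> (lam K < +oo)%E -> continuous f ->
  (forall x, ~ K x -> f x = 0) ->
  (forall n x, ~ K x -> f (s n *: x) = 0) ->
  s @ \oo --> (1 : R) ->
  (\int[lam]_x (f (s n *: x))%:E)%E @[n --> \oo] --> (\int[lam]_x (f x)%:E)%E.
Proof.
move=> clK cK lamK cf fK fsK s1; have mK := @closed_borel_measurable _ _ clK.
have [M fM] := compact_support_bounded cK cf fK.
apply: (@dominated_cvg _ _ _ lam setT measurableT
  (fun n x => (f (s n *: x))%:E) (EFin \o f) ((cst M%:E) \_ K)).
- move=> n; apply/measurable_EFinP.
  apply: continuous_borel_measurable => x.
  by apply: continuous_comp; [exact: continuous_scaler|exact: cf].
(* Pointwise limit: [s n *: x] tends to [1 *: x], and [f] is continuous. *)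
- move=> x _; apply: cvg_EFin; first exact: nearW.
  rewrite -[in X in _ --> X](scale1r (x : G)).
  apply: (cvg_comp (fun n => s n *: (x : G)) f); last exact: cf.
  by apply: (cvg_comp s (fun a => a *: (x : G)) s1); exact: continuous_scalel.
- by move=> x _; rewrite patchE; case: ifP.
- exact: integrable_cst_patch.
- move=> n x _; rewrite patchE; case: ifPn => [_|/negP]; rewrite ?inE.
    by rewrite lee_fin.
  by move=> /fsK ->; rewrite abse0.
Qed.

Theorem theorem32 (R : realType) (G : topologicalLmodType R)
  (hG : hausdorff_space G) (lcG : locally_compact [set: G])
  (lam : {measure set (borel_group G) -> \bar R}) (haar_lam : is_haar lam)
  (Op On : set G)
  (bOp : tvs_bounded Op) (bOn : tvs_bounded On)
  (sOp : zero_symmetric Op) (sOn : zero_symmetric On)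
  (rOp : forall r : R, 0 <= r -> r < 1 ->
     [set r *: x | x in closure Op] `<=` interior Op)
  (rOn : forall r : R, 0 <= r -> r < 1 ->
     [set r *: x | x in closure On] `<=` interior On) :
  Cstar lam (interior Op) (interior On) = Cstar lam (closure Op) (closure On).
Proof.
have iOp : interior Op `<=` closure Op.
  exact: subset_trans (@interior_subset _ _) (@subset_closure _ _).
have iOn : interior On `<=` closure On.
  exact: subset_trans (@interior_subset _ _) (@subset_closure _ _).
have cOp := tvs_bounded_closure_compact hG lcG bOp.
have cOn := tvs_bounded_closure_compact hG lcG bOn.
(* The factors decrease to 1 but stay strictly above it, so that each inverse is a ratio in [0, 1)
   to which [rOp] and [rOn] apply. *)
pose s n : R := 1 + harmonic n.
have s1 n : 1 < s n by rewrite ltrDl invr_gt0 ltr0n.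
have s0 n : 0 < s n := lt_trans ltr01 (s1 n).
have Fs f n : Fstar lam (closure Op) (closure On) f ->
    Fstar lam (interior Op) (interior On) (fun x => f (s n *: x)).
  apply: Fstar_dilation => //; try exact: closed_closure.
  - by apply: rOp; rewrite ?invr_ge0 ?ltW// invf_lt1.
  - by apply: rOn; rewrite ?invr_ge0 ?ltW// invf_lt1.
have FF : Fstar lam (interior Op) (interior On) `<=`
    Fstar lam (closure Op) (closure On).
  move=> f [Pf If fp fn]; split => //.
  - exact: subset_trans fp iOp.
  - exact: subset_trans fn iOn.
(* The two classes are empty together: by [FF] if the one for the closures is empty, while otherwise
   a dilate of [f0] lies in the one for the interiors. *)
rewrite /Cstar; have [F0|/set0P[f0 Ff0]] := eqVneq (Fstar _ (closure _) _) set0.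
  by rewrite ifT//; apply/eqP; rewrite -subset0 -F0.
rewrite ifF; last first.
  by apply/negbTE/set0P; exists (fun x => f0 (s 0%N *: x)); exact: Fs.
apply/eqP; rewrite eq_le; apply/andP; split.
  by apply: ereal_sup_le => _ [f Ff <-]; exists f => //; exact: FF.
(* Reverse inequality: the integral of [f] is the limit of the integrals of its dilates, each at
   most the supremum for the interiors. *)
apply: ge_ereal_sup => _ [f Ff <-].
have [[cf _ _] _ fp fn] := Ff.
have cK : compact (closure Op `|` closure On) by exact: compactU.
have scvg : s @ \oo --> (1 : R).
  rewrite -[1 in X in _ --> X]addr0.
  by apply: cvgD; [exact: cvg_cst|exact: cvg_harmonic].
apply: (@cvge_le _ _ _ _ _ _ _ _
  (@cvg_integral_dilation _ _ lam (closure Op `|` closure On) f s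
    _ cK _ cf _ _ scvg)).
- apply: nearW => n; apply: ereal_sup_ubound.
  by exists (fun x => f (s n *: x)) => //; exact: Fs.
- by apply: closedU; exact: closed_closure.
- exact: haar_compact haar_lam _ cK.
- by move=> x; exact: (supp_vanish fp fn).
- move=> n x; have [_ _ fsp fsn] := Fs f n Ff.
  exact: (supp_vanish (subset_trans fsp iOp) (subset_trans fsn iOn)).
Qed.
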